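(* Let $n,m\ge1$ be integers, let $P^m:\mathcal{S}(\mathbb{R}^n,\mathbb{C})\to\mathcal{S}(\mathbb{R}^n,\mathbb{C})$ be the power operator $P^m(f)=f^m$, and let $\bar f\in\mathcal{S}(\mathbb{R}^n,\mathbb{C})$. Then $P^m$ is Gâteaux differentiable at $\bar f$, and for every $u\in\mathcal{S}(\mathbb{R}^n,\mathbb{C})\setminus\{\theta_{\mathcal{S}}\}$: (i) if $m=1$, then $P'(\bar f)(u)=\nabla P(\bar f)(u)=u$ (where $P=P^1$); (ii) if $m>1$, then $(P^m)'(\bar f)(u)=\nabla P^m(\bar f)(u)=m\bar f^{\,m-1}u$.
   Context: $\mathbb{N}$ is the set of nonnegative integers. $\mathcal{S}(\mathbb{R}^n,\mathbb{C})$ is the Schwartz space of all $f\in C^\infty(\mathbb{R}^n,\mathbb{C})$ with $\|f\|_{\alpha,\beta}:=\sup_{x\in\mathbb{R}^n}|x^\alpha(D^\beta f)(x)|<\infty$ for all $\alpha,\beta\in\mathbb{N}^n$; its origin is $\theta_{\mathcal{S}}$, and its topology is induced by the family of seminorms $\mathbb{F}_{\mathcal{S}}=\{\|\cdot\|_{\alpha,\beta}:\alpha,\beta\in\mathbb{N}^n\}$. $\mathcal{F}_{\mathcal{S}}$ denotes the collection of nonempty finite subsets of $\mathbb{F}_{\mathcal{S}}$. Gâteaux differentiability: $T:\mathcal{S}(\mathbb{R}^n,\mathbb{C})\to\mathcal{S}(\mathbb{R}^n,\mathbb{C})$ is Gâteaux differentiable at $\bar f$ with Gâteaux derivative $T'(\bar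 f)$ if for every $u\ne\theta_{\mathcal{S}}$ there is $T'(\bar f)(u)\in\mathcal{S}(\mathbb{R}^n,\mathbb{C})$ such that for every $J\in\mathcal{F}_{\mathcal{S}}$ and $\varepsilon>0$ there is $\delta>0$ such that, for real $t$, $0<|t|<\delta$ implies $\max\left\{q\left(\frac{T(\bar f+tu)-T(\bar f)-tT'(\bar f)(u)}{t}\right):q\in J\right\}<\varepsilon$. Fréchet derivative: $\nabla T(\bar f)=A$ is the assertion that $A:\mathcal{S}(\mathbb{R}^n,\mathbb{C})\to\mathcal{S}(\mathbb{R}^n,\mathbb{C})$ is a continuous linear mapping such that for every $J\in\mathcal{F}_{\mathcal{S}}$ and $\varepsilon>0$ there are $I\in\mathcal{F}_{\mathcal{S}}$ and $\delta>0$ such that for all $u$: if $\max\{p(u):p\in I\}=0$ then $\max\{q(T(\bar f+u)-T(\bar f)-A(u)):q\in J\}=0$; and if $0<\max\{p(u):p\in I\}<\delta$ then $\max\left\{q\left(\frac{T(\bar f+u)-T(\bar f)-A(u)}{\max\{p(u):p\in I\}}\right):q\in J\right\}<\varepsilon$. *)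

(* Defs.v *)
From HB Require Import structures.
From mathcomp Require Import all_boot all_order all_algebra finmap.
From mathcomp Require Import boolp classical_sets functions filter.
From mathcomp Require Import reals topology normedtype derive.
From mathcomp Require Import complex.

Set Implicit Arguments.
Unset Strict Implicit.
Unset Printing Implicit Defensive.

Import Order.TTheory GRing.Theory Num.Theory.
Import numFieldNormedType.Exports.

Local Open Scope classical_set_scope.
Local Open Scope ring_scope.

Notation normc := ComplexField.Normc.normc.

Section Real.
Context {R : realType} {n : nat}.
Implicit Types (g h : 'rV[R]_n -> R) (s : seq 'I_n) (j : 'I_n).

Definition pderiv j h : 'rV[R]_n -> R := fun x => 'D_(delta_mx 0 j) h x.

(* [pderivs [:: j1; ...; jk] h] is d/dx_j1 (... (d/dx_jk h)). *)
Definition pderivs s h : 'rV[R]_n -> R := foldr pderiv h s.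

(* C^oo: the iterated partial derivatives, of every order and taken in every
   order of the variables, exist and are continuous. *)
Definition smooth h : Prop := forall s,
  continuous (pderivs s h) /\
  forall j x, derivable (pderivs s h) x (delta_mx 0 j).

(* The variables of the multi-index [b], listed with multiplicity. *)
Definition mseq (b : 'I_n -> nat) : seq 'I_n :=
  flatten [seq nseq (b j) j | j <- enum 'I_n].

Definition mderiv (b : 'I_n -> nat) h : 'rV[R]_n -> R := pderivs (mseq b) h.

Definition mpow (a : 'I_n -> nat) (x : 'rV[R]_n) : R := \prod_j x 0 j ^+ a j.

Lemma smooth_pderiv j h : smooth h -> smooth (pderiv j h).
Proof.
by move=> sh s; move: (sh (rcons s j)); rewrite /pderivs foldr_rcons.
Qed.

Lemma pderivs_cst0 s : pderivs s (fun=> 0) = fun=> 0.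
Proof.
elim: s => [//|j s /= ->]; apply/funext => x.
exact: (derive_cst (0 : R)).
Qed.

Lemma smooth0 : smooth (fun=> 0).
Proof.
by move=> s; rewrite pderivs_cst0; split=> [x|j x];
  [exact: cst_continuous|exact: derivable_cst].
Qed.

Lemma pderivsD s g h : smooth g -> smooth h ->
  pderivs s (fun x => g x + h x) = fun x => pderivs s g x + pderivs s h x.
Proof.
move=> sg sh; elim: s => [//|j s /= ->]; apply/funext => x.
by apply: deriveD; [apply: (sg s).2|apply: (sh s).2].
Qed.

Lemma smoothD g h : smooth g -> smooth h -> smooth (fun x => g x + h x).
Proof.
move=> sg sh s; rewrite pderivsD//; split=> [x|j x].
  exact: cvgD ((sg s).1 x) ((sh s).1 x).
by apply: derivableD; [apply: (sg s).2|apply: (sh s).2].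
Qed.

Lemma pderivsZ s (k : R) h : smooth h ->
  pderivs s (fun x => k * h x) = fun x => k * pderivs s h x.
Proof.
move=> sh; elim: s => [//|j s /= ->]; apply/funext => x.
by apply: deriveZ; apply: (sh s).2.
Qed.

Lemma smoothZ (k : R) h : smooth h -> smooth (fun x => k * h x).
Proof.
move=> sh s; rewrite pderivsZ//; split=> [x|j x].
  exact: cvgM (cvg_cst k) ((sh s).1 x).
by apply: derivableZ; apply: (sh s).2.
Qed.

(* The ways to distribute the successive derivations in [s] on two factors. *)
Fixpoint splits s : seq (seq 'I_n * seq 'I_n) :=
  if s is j :: s' then
    [seq (j :: p.1, p.2) | p <- splits s'] ++
    [seq (p.1, j :: p.2) | p <- splits s']
  else [:: ([::], [::])].

Lemma smooth_sum (I : Type) (r : seq I) (F : I -> 'rV[R]_n -> R) :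
  (forall i, smooth (F i)) -> smooth (fun x => \sum_(i <- r) F i x).
Proof.
move=> sF; elim: r => [|i r IH].
  by under eq_fun do rewrite big_nil; exact: smooth0.
by under eq_fun do rewrite big_cons; exact: smoothD.
Qed.

Lemma pderiv_sum j x (I : Type) (r : seq I) (F : I -> 'rV[R]_n -> R) :
  (forall i, derivable (F i) x (delta_mx 0 j)) ->
  derivable (fun x => \sum_(i <- r) F i x) x (delta_mx 0 j) /\
  pderiv j (fun x => \sum_(i <- r) F i x) x = \sum_(i <- r) pderiv j (F i) x.
Proof.
move=> dF; elim: r => [|i r [IH1 IH2]].
  under eq_fun do rewrite big_nil; rewrite big_nil.
  by split; [exact: derivable_cst|exact: (derive_cst (0 : R))].
under eq_fun do rewrite big_cons; rewrite big_cons -IH2; split.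
  exact: derivableD.
exact: deriveD.
Qed.

Lemma leibniz_derivable g h j s x : smooth g -> smooth h ->
  derivable (fun x => \sum_(p <- splits s) pderivs p.1 g x * pderivs p.2 h x)
    x (delta_mx 0 j).
Proof.
move=> sg sh; apply: (pderiv_sum _ _).1 => p.
by apply: derivableM; [apply: (sg p.1).2|apply: (sh p.2).2].
Qed.

Lemma pderivsM s g h : smooth g -> smooth h ->
  pderivs s (fun x => g x * h x) =
  fun x => \sum_(p <- splits s) pderivs p.1 g x * pderivs p.2 h x.
Proof.
move=> sg sh; elim: s => [|j s IH].
  by apply/funext => x; rewrite big_seq1.
rewrite [LHS]/= -/(pderivs s _) IH; apply/funext => x.
rewrite (pderiv_sum _ _).2; last first.
  by move=> p; apply: derivableM; [apply: (sg p.1).2|apply: (sh p.2).2].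
rewrite /= big_cat/= !big_map/= -big_split/=; apply: eq_bigr => p _.
rewrite {1}/pderiv (deriveM ((sg p.1).2 j x) ((sh p.2).2 j x)).
by rewrite addrC; congr (_ + _); exact: mulrC.
Qed.

Lemma smoothM g h : smooth g -> smooth h -> smooth (fun x => g x * h x).
Proof.
move=> sg sh s; split=> [x|j x]; rewrite pderivsM//; last first.
  exact: leibniz_derivable.
elim: (splits s) => [|p r IH].
  by under eq_fun do rewrite big_nil; exact: cst_continuous.
under eq_fun do rewrite big_cons; exact: cvgD (cvgM ((sg p.1).1 x) ((sh p.2).1 x)) IH.
Qed.

Lemma count_mseq (b : 'I_n -> nat) j : count_mem j (mseq b) = b j.
Proof.
rewrite /mseq count_flatten -map_comp sumnE big_map big_enum/=.
rewrite (bigD1 j)//= count_nseq/= eqxx mul1n big1 ?addn0//.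
by move=> i /negbTE ij; rewrite count_nseq/= ij.
Qed.

Lemma mseq_sorted (b : 'I_n -> nat) : sorted leq (map val (mseq b)).
Proof.
have : sorted leq (map val (enum 'I_n)) by rewrite val_enum_ord iota_sorted.
rewrite /mseq; elim: (enum 'I_n) => [//|j l IH] /=.
rewrite (path_sortedE leq_trans) => /andP[/allP jl /IH sl].
rewrite map_cat map_nseq.
elim: (b j) => [//|k IHk] /=; rewrite (path_sortedE leq_trans) IHk andbT.
rewrite all_cat all_nseq leqnn orbT/=; apply/allP => _ /mapP[i + ->].
move=> /flattenP[_ /mapP[i' i'l ->]] /nseqP[-> _].
by apply: jl; exact: map_f.
Qed.

Lemma sorted_mseq s :
  sorted leq (map val s) -> s = mseq (fun j => count_mem j s).
Proof.
move=> ss; apply: (inj_map val_inj).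
apply: (sorted_eq leq_trans anti_leq ss (mseq_sorted _)).
by apply/perm_map/allP => j _; rewrite /= count_mseq.
Qed.

Lemma splits_subseq s p :
  p \in splits s -> subseq p.1 s /\ subseq p.2 s.
Proof.
elim: s p => [|j s IH] p; first by rewrite inE => /eqP ->.
rewrite mem_cat => /orP[] /mapP[q /IH[q1 q2] ->]; split.
- by rewrite [subseq _ _]/= eqxx.
- exact: subseq_trans q2 (subseq_cons _ _).
- exact: subseq_trans q1 (subseq_cons _ _).
- by rewrite [subseq _ _]/= eqxx.
Qed.

(* In the Leibniz formula for [mderiv b], only multi-index derivatives occur. *)
Lemma splits_mseq b p : p \in splits (mseq b) ->
  exists b1 b2, p = (mseq b1, mseq b2).
Proof.
move=> /splits_subseq[p1 p2].
exists (fun j => count_mem j p.1), (fun j => count_mem j p.2).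
rewrite -!sorted_mseq; first by case: p {p1 p2}.
- exact: subseq_sorted leq_trans _ _ (map_subseq _ p2) (mseq_sorted b).
- exact: subseq_sorted leq_trans _ _ (map_subseq _ p1) (mseq_sorted b).
Qed.

End Real.

Section Complex.
Context {R : realType} {n : nat}.
Implicit Types (f g : 'rV[R]_n -> R[i]) (a b : 'I_n -> nat).

Local Open Scope complex_scope.

Definition fRe f : 'rV[R]_n -> R := fun x => complex.Re (f x).
Definition fIm f : 'rV[R]_n -> R := fun x => complex.Im (f x).

(* R[i] carries no normed R-module structure, so complex-valued functions are
   differentiated through their real and imaginary parts. *)
Definition csmooth f : Prop := smooth (fRe f) /\ smooth (fIm f).

Definition cpderivs (s : seq 'I_n) f : 'rV[R]_n -> R[i] :=
  fun x => pderivs s (fRe f) x +i* pderivs s (fIm f) x.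

Definition cmderiv b f : 'rV[R]_n -> R[i] :=
  fun x => mderiv b (fRe f) x +i* mderiv b (fIm f) x.

Definition weighted_values a b f : set R :=
  range (fun x => normc ((mpow a x)%:C * cmderiv b f x)).

Definition is_schwartz f : Prop :=
  csmooth f /\ forall a b, has_ubound (weighted_values a b f).

Lemma fReD f g : fRe (f + g) = fun x => fRe f x + fRe g x.
Proof. by apply/funext => x; rewrite /fRe /= addrfctE; case: (f x) (g x) => ? ? []. Qed.

Lemma fImD f g : fIm (f + g) = fun x => fIm f x + fIm g x.
Proof. by apply/funext => x; rewrite /fIm /= addrfctE; case: (f x) (g x) => ? ? []. Qed.

Lemma fReM f g : fRe (fun x => f x * g x) =
  fun x => fRe f x * fRe g x + -1 * (fIm f x * fIm g x).
Proof.
by apply/funext => x; rewrite /fRe /fIm mulN1r; case: (f x) (g x) => ? ? [].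
Qed.

Lemma fImM f g : fIm (fun x => f x * g x) =
  fun x => fRe f x * fIm g x + fIm f x * fRe g x.
Proof.
by apply/funext => x; rewrite /fRe /fIm; case: (f x) (g x) => ? ? [].
Qed.

Lemma csmoothD f g : csmooth f -> csmooth g -> csmooth (f + g).
Proof.
by move=> [f1 f2] [g1 g2]; rewrite /csmooth fReD fImD; split; exact: smoothD.
Qed.

Lemma csmoothM f g : csmooth f -> csmooth g -> csmooth (fun x => f x * g x).
Proof.
move=> [f1 f2] [g1 g2]; rewrite /csmooth fReM fImM; split.
  by apply: smoothD; [exact: smoothM|apply: smoothZ; exact: smoothM].
by apply: smoothD; exact: smoothM.
Qed.

Lemma cpderivsD s f g : csmooth f -> csmooth g ->
  cpderivs s (f + g) = fun x => cpderivs s f x + cpderivs s g x.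
Proof.
move=> [f1 f2] [g1 g2]; apply/funext => x.
by rewrite /cpderivs fReD fImD !pderivsD.
Qed.

Lemma cpderivsM s f g : csmooth f -> csmooth g ->
  cpderivs s (fun x => f x * g x) =
  fun x => \sum_(p <- splits s) cpderivs p.1 f x * cpderivs p.2 g x.
Proof.
move=> [f1 f2] [g1 g2]; apply/funext => x.
rewrite /cpderivs fReM fImM !pderivsD ?pderivsZ//; try exact: smoothM;
  try exact: smoothZ (smoothM _ _).
rewrite !pderivsM//.
elim: (splits s) => [|p r IH]; first by rewrite !big_nil mulr0 addr0.
rewrite !big_cons -IH -[RHS]/(_ +i* _); congr (_ +i* _);
  by rewrite ?mulN1r ?opprD addrACA.
Qed.

Lemma cpderivs_scal s (k : R[i]) f : csmooth f ->
  csmooth (k *: f) /\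
  cpderivs s (k *: f) = fun x => k * cpderivs s f x.
Proof.
case: k => kr ki [f1 f2].
have E1 : fRe ((kr +i* ki) *: f) = fun x => kr * fRe f x + (- ki) * fIm f x.
  apply/funext => x; rewrite /fRe /fIm scalrfctE mulNr.
  by case: (f x).
have E2 : fIm ((kr +i* ki) *: f) = fun x => kr * fIm f x + ki * fRe f x.
  by apply/funext => x; rewrite /fRe /fIm scalrfctE; case: (f x).
split.
  by split; rewrite ?E1 ?E2; apply: smoothD; exact: smoothZ.
apply/funext => x; rewrite /cpderivs E1 E2 !pderivsD; try exact: smoothZ.
by rewrite !pderivsZ// mulNr.
Qed.

Lemma csmooth0 : csmooth 0.
Proof. by split; exact: smooth0. Qed.

Lemma cpderivs0 s : cpderivs s 0 = 0.
Proof.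
apply/funext => x; rewrite /cpderivs -[fRe 0]/(fun=> 0) -[fIm 0]/(fun=> 0).
by rewrite pderivs_cst0.
Qed.

Lemma normcD (z w : R[i]) : normc (z + w) <= normc z + normc w.
Proof. exact: le_normcD. Qed.

Lemma normc_ge0 (z : R[i]) : 0 <= normc z.
Proof. by case: z => ? ?; exact: sqrtr_ge0. Qed.

Lemma is_schwartzP f : is_schwartz f <-> csmooth f /\
  forall a b, exists M, forall x, normc ((mpow a x)%:C * cmderiv b f x) <= M.
Proof.
split=> -[cf bf]; split=> // a b; have [M hM] := bf a b; exists M.
  by move=> x; apply: hM; exists x.
by move=> _ [x _ <-]; exact: hM.
Qed.

Lemma is_schwartz0 : is_schwartz 0.
Proof.
apply/is_schwartzP; split=> [|a b]; first exact: csmooth0.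
exists 0 => x; rewrite (_ : cmderiv b 0 = 0) ?mulr0; last exact: cpderivs0.
by rewrite ComplexField.Normc.normc0.
Qed.

Lemma is_schwartzD f g : is_schwartz f -> is_schwartz g -> is_schwartz (f + g).
Proof.
move=> /is_schwartzP[sf bf] /is_schwartzP[sg bg]; apply/is_schwartzP.
split=> [|a b]; first exact: csmoothD.
have [M hM] := bf a b; have [N hN] := bg a b; exists (M + N) => x.
rewrite [cmderiv _ _](cpderivsD _ sf sg) mulrDr.
by apply: le_trans (normcD _ _) _; exact: lerD.
Qed.

Lemma is_schwartzZ (k : R[i]) f : is_schwartz f -> is_schwartz (k *: f).
Proof.
move=> /is_schwartzP[sf bf]; apply/is_schwartzP.
split=> [|a b]; first by have [] := cpderivs_scal [::] k sf.
have [M hM] := bf a b; exists (normc k * M) => x.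
rewrite [cmderiv _ _](cpderivs_scal _ k sf).2 mulrCA.
rewrite ComplexField.Normc.normcM ler_wpM2l// normc_ge0//.
Qed.

Lemma is_schwartzM f g : is_schwartz f -> is_schwartz g ->
  is_schwartz (fun x => f x * g x).
Proof.
move=> /is_schwartzP[sf bf] /is_schwartzP[sg bg]; apply/is_schwartzP.
split=> [|a b]; first exact: csmoothM.
have mpow0 x : mpow (fun=> 0%N) x = 1 :> R by rewrite /mpow big1.
rewrite [cmderiv _ _](cpderivsM _ sf sg).
elim: (splits _) (@splits_mseq n b) => [_|p r IH pr].
  by exists 0 => x; rewrite big_nil mulr0 ComplexField.Normc.normc0.
have [|M hM] := IH; first by move=> q qr; apply: pr; rewrite inE qr orbT.
have [b1 [b2 pE]] := pr p (mem_head _ _).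
have [N1 hN1] := bf a b1; have [N2 hN2] := bg (fun=> 0%N) b2.
exists (N1 * N2 + M) => x; rewrite big_cons mulrDr.
apply: le_trans (normcD _ _) (lerD _ (hM x)).
rewrite mulrA ComplexField.Normc.normcM ler_pM ?normc_ge0//.
  by rewrite pE; exact: hN1.
by have := hN2 x; rewrite mpow0 mul1r pE.
Qed.

End Complex.

Definition schwartz_pred {R : realType} {n : nat} : {pred 'rV[R]_n -> R[i]} :=
  mem [set f | is_schwartz f].

Record schwartz (R : realType) (n : nat) := Schwartz {
  schwartz_fun :> 'rV[R]_n -> R[i];
  schwartz_subproof : schwartz_fun \in schwartz_pred }.

Section SchwartzSpace.
Context {R : realType} {n : nat}.
Implicit Types (f g u : schwartz R n) (a b : 'I_n -> nat).

Local Open Scope complex_scope.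

HB.instance Definition _ := [isSub for @schwartz_fun R n].
HB.instance Definition _ := [Choice of schwartz R n by <:].

Lemma schwartzP f : is_schwartz f.
Proof. by have := schwartz_subproof f; rewrite inE. Qed.

Lemma schwartz_submod_closed : submod_closed (@schwartz_pred R n).
Proof.
split; first by rewrite inE; exact: is_schwartz0.
move=> k f g; rewrite !inE => sf sg.
by apply: is_schwartzD => //; exact: is_schwartzZ.
Qed.

HB.instance Definition _ :=
  GRing.isSubmodClosed.Build _ _ (@schwartz_pred R n) schwartz_submod_closed.
HB.instance Definition _ := [SubChoice_isSubLmodule of schwartz R n by <:].

Lemma schwartz_mul_subproof f g :
  (fun x => f x * g x) \in @schwartz_pred R n.
Proof. by rewrite inE; apply: is_schwartzM; exact: schwartzP. Qed.

Definition schwartz_mul f g : schwartz R n :=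
  Schwartz (schwartz_mul_subproof f g).

(* The power operator [P^m], for [0 < m]: see [schwartz_powerE].  The constant
   [f^0 = 1] is not a Schwartz function, and the value at [m = 0] is junk. *)
Definition schwartz_power (m : nat) f : schwartz R n :=
  iter m.-1 (schwartz_mul f) f.

Lemma schwartz_powerE (m : nat) f x : (0 < m)%N ->
  schwartz_power m f x = f x ^+ m.
Proof.
case: m => [//|m _]; rewrite /schwartz_power/=.
by elim: m => [|m IH] /=; rewrite ?expr1// exprS IH.
Qed.

Definition seminorm a b f : R := sup (weighted_values a b f).

Definition seminorm_family : set (schwartz R n -> R) :=
  [set q | exists a b, q = seminorm a b].

Definition finite_seminorms : set {fset (schwartz R n -> R)} :=
  [set J | J != fset0 /\ forall q, q \in J -> seminorm_family q].

(* Seminorms are nonnegative, so that 0 is neutral in this maximum. *)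
Definition max_seminorm (J : {fset (schwartz R n -> R)}) f : R :=
  \big[Num.max/0]_(q <- J) q f.

Lemma seminorm_ub a b f x :
  normc ((mpow a x)%:C * cmderiv b f x) <= seminorm a b f.
Proof.
apply: sup_upper_bound; last by exists x.
by split; [exists (normc ((mpow a 0)%:C * cmderiv b f 0)), 0|exact: (schwartzP f).2].
Qed.

Lemma seminorm_ge0 a b f : 0 <= seminorm a b f.
Proof. exact: le_trans (normc_ge0 _) (seminorm_ub a b f 0). Qed.

Lemma seminorm_le a b f (M : R) :
  (forall x, normc ((mpow a x)%:C * cmderiv b f x) <= M) -> seminorm a b f <= M.
Proof.
move=> fM; apply: ge_sup; first by exists (normc ((mpow a 0)%:C * cmderiv b f 0)), 0.
by move=> _ [x _ <-].
Qed.

Lemma seminorm0 a b : seminorm a b 0 = 0.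
Proof.
apply/eqP; rewrite eq_le seminorm_ge0 andbT; apply: seminorm_le => x.
rewrite (_ : cmderiv b (0 : schwartz R n) = 0) ?mulr0; last exact: cpderivs0.
by rewrite ComplexField.Normc.normc0.
Qed.

Lemma seminormD a b f g : seminorm a b (f + g) <= seminorm a b f + seminorm a b g.
Proof.
apply: seminorm_le => x.
rewrite (_ : cmderiv b (f + g) = fun x => cmderiv b f x + cmderiv b g x); last first.
  exact: (cpderivsD _ (schwartzP f).1 (schwartzP g).1).
rewrite mulrDr; apply: le_trans (normcD _ _) _.
by apply: lerD; exact: seminorm_ub.
Qed.

Lemma le_max_seminorm (J : {fset (schwartz R n -> R)}) f q :
  q \in J -> q f <= max_seminorm J f.
Proof.
by move=> qJ; exact: (Order.TotalTheory.le_bigmax_seq 0 _ xpredT (fun q => q f) qJ).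
Qed.

Lemma max_seminorm_lt (J : {fset (schwartz R n -> R)}) f (e : R) : 0 < e ->
  max_seminorm J f < e <-> forall q, q \in J -> q f < e.
Proof.
move=> e0; split=> [h q qJ|h].
  exact: le_lt_trans (le_max_seminorm _ qJ) h.
rewrite /max_seminorm big_seq; elim/big_ind: _ => // x y xe ye.
by rewrite gt_max xe.
Qed.

Definition schwartz_ball f (J : {fset (schwartz R n -> R)}) (e : R) :
  set (schwartz R n) := [set g | max_seminorm J (g - f) < e].

Definition schwartz_nbhs f : set_system (schwartz R n) :=
  [set A | exists J e, [/\ finite_seminorms J, 0 < e & schwartz_ball f J e `<=` A]].

HB.instance Definition _ := hasNbhs.Build (schwartz R n) schwartz_nbhs.

Lemma finite_seminorms1 a b : finite_seminorms [fset (seminorm a b : schwartz R n -> R)]%fset.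
Proof.
split; first by apply/fset0Pn; exists (seminorm a b); rewrite inE.
by move=> q; rewrite inE => /eqP ->; exists a, b.
Qed.

Lemma finite_seminormsU J K : finite_seminorms J -> finite_seminorms K ->
  finite_seminorms (J `|` K)%fset.
Proof.
move=> [/fset0Pn[q qJ] hJ] [_ hK]; split.
  by apply/fset0Pn; exists q; rewrite inE qJ.
by move=> p; rewrite inE => /orP[/hJ|/hK].
Qed.

Let nbhs_pfilter f : ProperFilter (schwartz_nbhs f).
Proof.
have ballxx g J e : finite_seminorms J -> 0 < e -> schwartz_ball g J e g.
  move=> [_ hJ] e0; apply/max_seminorm_lt => // q /hJ[a [b ->]].
  by rewrite subrr seminorm0.
apply: Build_ProperFilter_ex.
  by move=> A [J [e [hJ e0 JA]]]; exists f; apply: JA; exact: ballxx.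
split.
- exists [fset seminorm (fun=> 0%N) (fun=> 0%N)]%fset, 1.
  by split => //; exact: finite_seminorms1.
- move=> A B [J [e [hJ e0 JA]]] [K [d [hK d0 KB]]].
  exists (J `|` K)%fset, (Num.min e d).
  split; [exact: finite_seminormsU|by rewrite lt_min e0|].
  move=> g /max_seminorm_lt; rewrite lt_min e0 d0 => /(_ isT) h; split.
    apply: JA; apply/max_seminorm_lt => // q qJ.
    by have := h q; rewrite inE qJ lt_min => /(_ isT)/andP[].
  apply: KB; apply/max_seminorm_lt => // q qK.
  by have := h q; rewrite inE qK orbT lt_min => /(_ isT)/andP[].
- move=> A B AB [J [e [hJ e0 JA]]]; exists J, e; split => //.
  exact: subset_trans AB.
Qed.

Let nbhs_self f (A : set (schwartz R n)) : schwartz_nbhs f A -> A f.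
Proof.
move=> [J [e [[_ hJ] e0 JA]]]; apply/JA/max_seminorm_lt => // q /hJ[a [b ->]].
by rewrite subrr seminorm0.
Qed.

Let nbhs_nbhs f (A : set (schwartz R n)) :
  schwartz_nbhs f A -> schwartz_nbhs f (schwartz_nbhs^~ A).
Proof.
move=> [J [e [hJ e0 JA]]]; exists J, e; split => // g gf.
exists J, (e - max_seminorm J (g - f)); split; rewrite ?subr_gt0//.
move=> h hg; apply: JA; apply/max_seminorm_lt => // q qJ.
have [a [b qE]] := hJ.2 _ qJ.
have -> : h - f = (h - g) + (g - f) by rewrite addrA subrK.
have le : q ((h - g) + (g - f)) <= q (h - g) + q (g - f).
  by rewrite qE; exact: seminormD.
apply: (le_lt_trans le); rewrite -ltrBrDr.
have : q (h - g) < e - max_seminorm J (g - f).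
  by move: q qJ {qE le}; apply/max_seminorm_lt; rewrite ?subr_gt0.
move=> /lt_le_trans; apply; rewrite lerD2l lerN2.
exact: le_max_seminorm.
Qed.

HB.instance Definition _ :=
  Nbhs_isNbhsTopological.Build (schwartz R n) nbhs_pfilter nbhs_self nbhs_nbhs.

(* [dT u] is only constrained for [u != 0]. *)
Definition gateaux_derivative (T : schwartz R n -> schwartz R n) f
    (dT : schwartz R n -> schwartz R n) : Prop :=
  forall u, u != 0 ->
  forall J (e : R), finite_seminorms J -> 0 < e ->
  exists2 d : R, 0 < d & forall t : R, 0 < `|t| -> `|t| < d ->
    max_seminorm J
      ((t^-1)%:C *: (T (f + t%:C *: u) - T f - t%:C *: dT u)) < e.

(* A relation rather than a choice of derivative: since [I] may depend on [e],
   the condition does not determine [A]. *)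
Definition frechet_derivative (T : schwartz R n -> schwartz R n) f
    (A : schwartz R n -> schwartz R n) : Prop :=
  [/\ linear A, continuous A &
  forall J (e : R), finite_seminorms J -> 0 < e ->
  exists I (d : R), [/\ finite_seminorms I, 0 < d & forall u,
    (max_seminorm I u = 0 -> max_seminorm J (T (f + u) - T f - A u) = 0) /\
    (0 < max_seminorm I u -> max_seminorm I u < d ->
      max_seminorm J
        (((max_seminorm I u)^-1)%:C *: (T (f + u) - T f - A u)) < e)]].

End SchwartzSpace.

(* Main.v *)
(* By the Leibniz formula each seminorm of a product is bounded by products of
   seminorms of the factors, so that orders of vanishing at the origin add up
   under multiplication. With A_m u = m f^(m-1) u and r_m the
   remainder P^m(f + u) - P^m(f) - A_m u, one has
   r_(m+1) = f r_m + u A_m u + u r_m, hence r_m = O(u^2) by induction. A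
   quadratic remainder gives both kinds of differentiability. *)
Require Import Defs.
From mathcomp Require Import all_boot all_order all_algebra finmap.
From mathcomp Require Import boolp classical_sets filter.
From mathcomp Require Import reals topology complex ring.

Import Order.TTheory GRing.Theory Num.Theory.

Set Implicit Arguments.
Unset Strict Implicit.
Unset Printing Implicit Defensive.

Local Open Scope classical_set_scope.
Local Open Scope ring_scope.

Section Seminorms.
Context {R : realType} {n : nat}.
Implicit Types (f g u : schwartz R n) (a b : 'I_n -> nat).
Implicit Types (I J : {fset (schwartz R n -> R)}).

Local Open Scope complex_scope.

(** * Pointwise operations and estimates for a single seminorm *)

Lemma schwartz_ext f g : (forall x, f x = g x) -> f = g.
Proof. by move=> fg; apply/val_inj/funext. Qed.

Lemma schwartzD_fun f g x : (f + g) x = f x + g x.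
Proof. by []. Qed.

Lemma schwartzN_fun f x : (- f) x = - f x.
Proof. by []. Qed.

Lemma schwartzZ_fun (k : R[i]) f x : (k *: f) x = k * f x.
Proof. by []. Qed.

Lemma schwartz_mul_fun f g x : schwartz_mul f g x = f x * g x.
Proof. by []. Qed.

Definition schwartz_funE :=
  (schwartzD_fun, schwartzN_fun, schwartzZ_fun, schwartz_mul_fun).

Lemma normc_real (t : R) : normc t%:C = `|t|.
Proof. by rewrite /= expr0n /= addr0 sqrtr_sqr. Qed.

Lemma seminormZ a b (k : R[i]) f :
  seminorm a b (k *: f) <= normc k * seminorm a b f.
Proof.
apply: seminorm_le => x.
rewrite [cmderiv _ _](cpderivs_scal _ k (schwartzP f).1).2 mulrCA.
by rewrite ComplexField.Normc.normcM ler_wpM2l ?normc_ge0// seminorm_ub.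
Qed.

(** The Leibniz formula, with the whole weight [a] put on [f] and weight 1 on [g]. Counting
    occurrences recovers the multi-indices of the two derivatives, because sublists of [mseq b] are
    again sorted. *)
Lemma seminorm_mul a b f g : seminorm a b (schwartz_mul f g) <=
  \sum_(p <- splits (mseq b)) seminorm a (fun j => count_mem j p.1) f *
    seminorm (fun=> 0%N) (fun j => count_mem j p.2) g.
Proof.
apply: seminorm_le => x.
rewrite [cmderiv _ _](cpderivsM _ (schwartzP f).1 (schwartzP g).1).
(* [splits_mseq] is carried through the induction as a hypothesis on the remaining list. *)
elim: (splits _) (@splits_mseq n b) => [_|p r IH pr].
  by rewrite !big_nil mulr0 ComplexField.Normc.normc0.
rewrite !big_cons mulrDr; apply: le_trans (normcD _ _) (lerD _ (IH _)); last first.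
  by move=> q qr; apply: pr; rewrite inE qr orbT.
have [b1 [b2 pE]] := pr p (mem_head _ _).
have -> : (fun j => count_mem j p.1) = b1.
  by apply/funext => j; rewrite pE count_mseq.
have -> : (fun j => count_mem j p.2) = b2.
  by apply/funext => j; rewrite pE count_mseq.
rewrite mulrA ComplexField.Normc.normcM pE.
apply: ler_pM; [exact: normc_ge0|exact: normc_ge0|exact: seminorm_ub|].
by have := seminorm_ub (fun=> 0%N) b2 g x; rewrite /mpow big1// mul1r.
Qed.

(** * Maxima over finite sets of seminorms *)

Lemma max_seminorm_ge0 J f : 0 <= max_seminorm J f.
Proof.
rewrite /max_seminorm; elim/big_rec: _ => // q y _ y0.
by rewrite le_max y0 orbT.
Qed.

Lemma max_seminorm_le J f (M : R) : 0 <= M ->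
  (forall q, q \in J -> q f <= M) -> max_seminorm J f <= M.
Proof.
move=> M0 h; rewrite /max_seminorm big_seq; elim/big_ind: _ => // x y xM yM.
by rewrite ge_max xM.
Qed.

Lemma max_seminormZ J (k : R[i]) f : finite_seminorms J ->
  max_seminorm J (k *: f) <= normc k * max_seminorm J f.
Proof.
move=> [_ hJ]; apply: max_seminorm_le => [|q qJ].
  by rewrite mulr_ge0 ?normc_ge0 ?max_seminorm_ge0.
have [a [b qE]] := hJ _ qJ; rewrite {1}qE.
apply: le_trans (seminormZ _ _ _ _) _.
by rewrite -qE ler_wpM2l ?normc_ge0// le_max_seminorm.
Qed.

Lemma max_seminorm_subset I J f : {subset I <= J} ->
  max_seminorm I f <= max_seminorm J f.
Proof.
move=> IJ; apply: max_seminorm_le (max_seminorm_ge0 _ _) _ => q qI.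
exact/le_max_seminorm/IJ.
Qed.

(** Serves to bring separate estimates to a common set of seminorms and a common constant. *)
Lemma max_seminormX_le I J (C D : R) k f : {subset I <= J} -> 0 <= C <= D ->
  C * max_seminorm I f ^+ k <= D * max_seminorm J f ^+ k.
Proof.
move=> IJ /andP[C0 CD]; apply: ler_pM => //.
  by rewrite exprn_ge0 ?max_seminorm_ge0.
by rewrite lerXn2r ?nnegrE ?max_seminorm_ge0 ?max_seminorm_subset.
Qed.

(** * Calculus of orders of vanishing at the origin *)

(* [schwartz_bigO k r]: [r u = O(u^k)] as [u -> 0]. *)
Definition schwartz_bigO (k : nat) (r : schwartz R n -> schwartz R n) : Prop :=
  forall a b, exists I (C : R), [/\ finite_seminorms I, 0 <= C &
    forall u, max_seminorm I u <= 1 ->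
      seminorm a b (r u) <= C * max_seminorm I u ^+ k].

Lemma bigO_seq k r (s : seq (schwartz R n -> R)) : schwartz_bigO k r ->
  (forall q, q \in s -> seminorm_family q) ->
  exists I (C : R), [/\ finite_seminorms I, 0 <= C &
    forall u, max_seminorm I u <= 1 ->
      forall q, q \in s -> q (r u) <= C * max_seminorm I u ^+ k].
Proof.
move=> rO; elim: s => [_|q s IH hs].
  (* Any seminorm will do here: [I] only has to be nonempty. *)
  exists [fset seminorm (fun=> 0%N) (fun=> 0%N)]%fset, 0.
  by split => //; exact: finite_seminorms1.
have [q' q's|I [C [hI C0 hC]]] := IH; first by apply: hs; rewrite inE q's orbT.
have [a [b qE]] := hs q (mem_head _ _).
have [K [D [hK D0 hD]]] := rO a b.
exists (I `|` K)%fset, (C + D); split; [exact: finite_seminormsU|exact: addr_ge0|].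
have IIK : {subset I <= (I `|` K)%fset} by move=> x xI; rewrite inE xI.
have KIK : {subset K <= (I `|` K)%fset} by move=> x xK; rewrite inE xK orbT.
move=> u u1 p; rewrite inE => /orP[/eqP ->|ps].
  rewrite qE; apply: le_trans (hD _ (le_trans (max_seminorm_subset _ KIK) u1)) _.
  by apply: max_seminormX_le => //; rewrite D0 lerDr.
apply: le_trans (hC _ (le_trans (max_seminorm_subset _ IIK) u1) _ ps) _.
by apply: max_seminormX_le => //; rewrite C0 lerDl.
Qed.

Lemma bigO_max k r J : schwartz_bigO k r -> finite_seminorms J ->
  exists I (C : R), [/\ finite_seminorms I, 0 < C &
    forall u, max_seminorm I u <= 1 ->
      max_seminorm J (r u) <= C * max_seminorm I u ^+ k].
Proof.
move=> rO [_ hJ]; have [I [C [hI C0 hC]]] := bigO_seq (s := J) rO hJ.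
(* Adding 1 makes the constant strictly positive, so that thresholds such as [e / C] make sense. *)
exists I, (C + 1); split => // [|u u1]; first by rewrite ltr_wpDl.
have pk : 0 <= max_seminorm I u ^+ k by rewrite exprn_ge0 ?max_seminorm_ge0.
apply: max_seminorm_le => [|q qJ]; first by rewrite mulr_ge0// addr_ge0.
by apply: le_trans (hC _ u1 _ qJ) _; rewrite ler_wpM2r// lerDl.
Qed.

Lemma bigO_id : schwartz_bigO 1 id.
Proof.
move=> a b; exists [fset seminorm a b]%fset, 1; split => //.
  exact: finite_seminorms1.
by move=> u _; rewrite mul1r expr1 le_max_seminorm// inE.
Qed.

Lemma bigO_cst f : schwartz_bigO 0 (fun=> f).
Proof.
move=> a b; exists [fset seminorm a b]%fset, (seminorm a b f); split.
- exact: finite_seminorms1.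
- exact: seminorm_ge0.
- by move=> u _; rewrite expr0 mulr1.
Qed.

Lemma bigO_zero k : schwartz_bigO k (fun=> 0).
Proof.
move=> a b; exists [fset seminorm a b]%fset, 0; split => //.
  exact: finite_seminorms1.
by move=> u _; rewrite seminorm0 mul0r.
Qed.

Lemma bigO_weaken k l r : (k <= l)%N -> schwartz_bigO l r -> schwartz_bigO k r.
Proof.
move=> kl rO a b; have [I [C [hI C0 hC]]] := rO a b.
exists I, C; split => // u u1; apply: le_trans (hC _ u1) _.
(* Since [max_seminorm I u <= 1], its powers decrease as the exponent grows. *)
by rewrite ler_wpM2l// ler_wiXn2l// max_seminorm_ge0.
Qed.

Lemma bigO_scale k (c : R[i]) r :
  schwartz_bigO k r -> schwartz_bigO k (fun u => c *: r u).
Proof.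
move=> rO a b; have [I [C [hI C0 hC]]] := rO a b.
exists I, (normc c * C); split => // [|u u1]; first by rewrite mulr_ge0// normc_ge0.
apply: le_trans (seminormZ _ _ _ _) _.
by rewrite -mulrA ler_wpM2l ?normc_ge0// hC.
Qed.

Lemma bigO_common k l r1 r2 (s1 s2 : seq (schwartz R n -> R)) :
  schwartz_bigO k r1 -> schwartz_bigO l r2 ->
  (forall q, q \in s1 -> seminorm_family q) ->
  (forall q, q \in s2 -> seminorm_family q) ->
  exists I (C : R), [/\ finite_seminorms I, 0 <= C &
    forall u, max_seminorm I u <= 1 ->
      (forall q, q \in s1 -> q (r1 u) <= C * max_seminorm I u ^+ k) /\
      (forall q, q \in s2 -> q (r2 u) <= C * max_seminorm I u ^+ l)].
Proof.
move=> O1 O2 h1 h2.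
have [I [C [hI C0 hC]]] := bigO_seq O1 h1.
have [K [D [hK D0 hD]]] := bigO_seq O2 h2.
exists (I `|` K)%fset, (C + D); split; [exact: finite_seminormsU|exact: addr_ge0|].
have IIK : {subset I <= (I `|` K)%fset} by move=> x xI; rewrite inE xI.
have KIK : {subset K <= (I `|` K)%fset} by move=> x xK; rewrite inE xK orbT.
move=> u u1; split=> q qs.
  apply: le_trans (hC _ (le_trans (max_seminorm_subset _ IIK) u1) _ qs) _.
  by apply: max_seminormX_le => //; rewrite C0 lerDl.
apply: le_trans (hD _ (le_trans (max_seminorm_subset _ KIK) u1) _ qs) _.
by apply: max_seminormX_le => //; rewrite D0 lerDr.
Qed.

Lemma bigO_add k r1 r2 : schwartz_bigO k r1 -> schwartz_bigO k r2 ->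
  schwartz_bigO k (fun u => r1 u + r2 u).
Proof.
move=> O1 O2 a b.
have h q : q \in [:: seminorm a b : schwartz R n -> R] -> seminorm_family q.
  by rewrite inE => /eqP ->; exists a, b.
have [I [C [hI C0 hC]]] := bigO_common O1 O2 h h.
exists I, (C + C); split => // [|u u1]; first exact: addr_ge0.
have [h1 h2] := hC _ u1.
by apply: le_trans (seminormD _ _ _ _) _; rewrite mulrDl lerD ?h1 ?h2 ?mem_head.
Qed.

(** Each term of [seminorm_mul] is a product of a bound of order [k] and one of order [l];
    [bigO_common] lets all terms share [I] and [C]. *)
Lemma bigO_mul k l r1 r2 : schwartz_bigO k r1 -> schwartz_bigO l r2 ->
  schwartz_bigO (k + l) (fun u => schwartz_mul (r1 u) (r2 u)).
Proof.
move=> O1 O2 a b.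
pose q1 (p : seq 'I_n * seq 'I_n) : schwartz R n -> R :=
  seminorm a (fun j => count_mem j p.1).
pose q2 (p : seq 'I_n * seq 'I_n) : schwartz R n -> R :=
  seminorm (fun=> 0%N) (fun j => count_mem j p.2).
have h1 q : q \in map q1 (splits (mseq b)) -> seminorm_family q.
  by move=> /mapP[p _ ->]; eexists; eexists.
have h2 q : q \in map q2 (splits (mseq b)) -> seminorm_family q.
  by move=> /mapP[p _ ->]; eexists; eexists.
have [I [C [hI C0 hC]]] := bigO_common O1 O2 h1 h2.
exists I, (\sum_(p <- splits (mseq b)) C * C); split => // [|u u1].
  by apply: sumr_ge0 => p _; exact: mulr_ge0.
have {h1 h2} [h1 h2] := hC _ u1.
apply: le_trans (seminorm_mul _ _ _ _) _.
rewrite mulr_suml big_seq [leRHS]big_seq; apply: ler_sum => p ps.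
rewrite exprD mulrACA ler_pM ?seminorm_ge0//.
  by apply: h1; exact: map_f.
by apply: h2; exact: map_f.
Qed.

(** * From orders of vanishing to continuity and differentiability *)

(** By linearity the estimate at the origin transfers to every point [f]. *)
Lemma bigO1_continuous (A : schwartz R n -> schwartz R n) :
  linear A -> schwartz_bigO 1 A -> continuous A.
Proof.
move=> lA AO f B [J [e [hJ e0 JB]]].
have [I [C [hI C0 hC]]] := bigO_max AO hJ.
exists I, (Num.min 1 (e / C)); split => //.
  by rewrite lt_min ltr01 divr_gt0.
move=> g; rewrite /schwartz_ball/= lt_min ltr_pdivlMr// => /andP[g1 ge].
apply: JB; rewrite /schwartz_ball/=.
have -> : A g - A f = A (g - f).
  by have := lA (-1) f g; rewrite !scaleN1r addrC => <-; rewrite addrC.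
by apply: le_lt_trans (hC _ (ltW g1)) _; rewrite expr1 mulrC.
Qed.

Section Differentiability.
Variables (T : schwartz R n -> schwartz R n) (f : schwartz R n).
Variable A : schwartz R n -> schwartz R n.
Hypothesis linA : linear A.
Hypothesis remO : schwartz_bigO 2 (fun u => T (f + u) - T f - A u).

(** The remainder at [t u] is of order [t^2]; division by [t] leaves a factor [t]. *)
Lemma bigO2_gateaux : gateaux_derivative T f A.
Proof.
move=> u _ J e hJ e0; have [I [C [hI C0 hC]]] := bigO_max remO hJ.
pose p := max_seminorm I u.
have p0 : 0 <= p := max_seminorm_ge0 I u.
have p1 : 0 < p + 1 by rewrite ltr_wpDl.
(* The first bound puts [t u] where the estimate applies, the second gives
   [C * |t| * (p + 1)^2 < e]. Using [p + 1] keeps the divisors positive even if [p = 0]. *)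
exists (Num.min (p + 1)^-1 (e / (C * (p + 1) ^+ 2))).
  by rewrite lt_min invr_gt0 p1 divr_gt0// mulr_gt0// exprn_gt0.
move=> t t0; rewrite lt_min => /andP[tp].
rewrite ltr_pdivlMr ?mulr_gt0 ?exprn_gt0// => te.
have ptu : max_seminorm I (t%:C *: u) <= `|t| * (p + 1).
  apply: le_trans (max_seminormZ _ _ hI) _.
  by rewrite normc_real ler_wpM2l// lerDl.
have tp1 : `|t| * (p + 1) <= 1.
  by rewrite -ler_pdivlMr// mul1r ltW.
apply: le_lt_trans (max_seminormZ _ _ hJ) _.
rewrite normc_real normfV mulrC ltr_pdivrMr//.
(* Moving the scalar inside [A] exhibits the remainder at the increment [t u]. *)
have -> : t%:C *: A u = A (t%:C *: u).
  have A0 : A 0 = 0.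
    by have := linA (-1) 0 0; rewrite scaler0 addr0 scaleN1r addNr.
  by have := linA t%:C u 0; rewrite !addr0 A0 addr0 => ->.
apply: le_lt_trans (hC _ (le_trans ptu tp1)) _.
apply: (@le_lt_trans _ _ (C * (`|t| * (p + 1)) ^+ 2)).
  rewrite (ler_wpM2l (ltW C0))// lerXn2r// nnegrE ?max_seminorm_ge0//.
  by rewrite mulr_ge0// ltW.
by rewrite exprMn mulrCA expr2 -mulrA [ltRHS]mulrC ltr_pM2l.
Qed.

(** Dividing the bound [C * p^2], with [p = max_seminorm I u], by [p] leaves [C * p]; for [p = 0]
    the bound itself vanishes. The same [I] serves every [e]. *)
Lemma bigO2_frechet : continuous A -> frechet_derivative T f A.
Proof.
move=> cA; split => // J e hJ e0.
have [I [C [hI C0 hC]]] := bigO_max remO hJ.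
exists I, (Num.min 1 (e / C)); split => //.
  by rewrite lt_min ltr01 divr_gt0.
move=> u; split=> [u0|u0].
  apply/eqP; rewrite eq_le max_seminorm_ge0 andbT.
  by apply: le_trans (hC u _) _; rewrite u0 ?ler01// expr0n mulr0.
rewrite lt_min ltr_pdivlMr// => /andP[u1 ue].
apply: le_lt_trans (max_seminormZ _ _ hJ) _.
rewrite normc_real normfV (gtr0_norm u0) mulrC ltr_pdivrMr//.
apply: le_lt_trans (hC _ (ltW u1)) _.
by rewrite expr2 mulrA ltr_pM2r// mulrC.
Qed.

End Differentiability.

(** * The derivative and the remainder of the power operator *)

(* Junk exponent: [schwartz_power 0] is not the constant [1], so [m = 1] has to
   be separated. *)
Definition power_derivative (m : nat) f u : schwartz R n :=
  if m == 1%N then u else m%:R *: schwartz_mul (schwartz_power m.-1 f) u.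

(** Pointwise [f x ^+ 0] is 1, so a single formula covers [m = 1] as well. *)
Lemma power_derivativeE m f u x : (0 < m)%N ->
  power_derivative m f u x = m%:R * f x ^+ m.-1 * u x.
Proof.
rewrite /power_derivative; case: eqP => [->|]; first by rewrite expr0 !mul1r.
case: m => [|[|m]] // _ _.
by rewrite !schwartz_funE schwartz_powerE// mulrA.
Qed.

Lemma power_derivative_linear m f : (0 < m)%N -> linear (power_derivative m f).
Proof.
move=> m0 k u v; apply: schwartz_ext => x.
rewrite !schwartz_funE !power_derivativeE// !schwartz_funE; ring.
Qed.

Lemma power_derivative_bigO m f : schwartz_bigO 1 (power_derivative m f).
Proof.
rewrite /power_derivative; case: eqP => _; first exact: bigO_id.
by apply: bigO_scale; apply: (@bigO_mul 0); [exact: bigO_cst|exact: bigO_id].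
Qed.

Lemma power_remainderS m f u : (0 < m)%N ->
  let rem k := schwartz_power k (f + u) - schwartz_power k f
               - power_derivative k f u in
  rem m.+1 = schwartz_mul f (rem m) +
    (schwartz_mul u (power_derivative m f u) + schwartz_mul u (rem m)).
Proof.
move=> m0; apply: schwartz_ext => x.
rewrite !schwartz_funE !power_derivativeE// !schwartz_powerE// !schwartz_funE/=.
(* With [m] a successor, [m.-1] disappears and both sides become polynomials in [f x] and [u x]. *)
case: m m0 => // m _; rewrite /= !exprS -natr1; ring.
Qed.

Lemma power_remainder_bigO m f : (0 < m)%N -> schwartz_bigO 2
  (fun u => schwartz_power m (f + u) - schwartz_power m f - power_derivative m f u).
Proof.
case: m => // m _; elim: m => [|m IH].
  rewrite [X in schwartz_bigO _ X](_ : _ = fun=> 0); first exact: bigO_zero.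
  apply/funext => u; rewrite /power_derivative/= /schwartz_power/=.
  by rewrite addrAC addrK subrr.
under eq_fun do rewrite power_remainderS//.
(* The three terms have orders 0 + 2, 1 + 1 and 1 + 2; the last is weakened to 2. *)
apply: bigO_add; first by apply: (@bigO_mul 0) => //; exact: bigO_cst.
apply: bigO_add.
  by apply: (@bigO_mul 1 1); [exact: bigO_id|exact: power_derivative_bigO].
by apply: (@bigO_weaken 2 3) => //; apply: (@bigO_mul 1 2) => //; exact: bigO_id.
Qed.

End Seminorms.

Theorem proposition5p10 (R : realType) (n m : nat) (f : schwartz R n)
  (hn : (1 <= n)%N) (hm : (1 <= m)%N) :
  exists dP nablaP : schwartz R n -> schwartz R n,
    [/\ gateaux_derivative (schwartz_power m) f dP,
        frechet_derivative (schwartz_power m) f nablaP &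
        forall u : schwartz R n, u != 0 ->
          (m = 1%N -> dP u = nablaP u /\ nablaP u = u) /\
          ((1 < m)%N -> dP u = nablaP u /\
            nablaP u = m%:R *: schwartz_mul (schwartz_power m.-1 f) u)].
Proof.
have lA := power_derivative_linear f hm.
have rO := power_remainder_bigO f hm.
exists (power_derivative m f), (power_derivative m f); split.
- exact: bigO2_gateaux.
- apply: bigO2_frechet => //.
  exact: bigO1_continuous (power_derivative_bigO m f).
- move=> u _; rewrite /power_derivative; split=> [->//|m1].
  by rewrite gtn_eqF.
Qed.
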